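(* Let $\omega$ be a majorant for which there exist constants $\delta_0>0$ and $M>0$ with $$\int_0^{\delta}\frac{\omega(t)}{t}\,dt\le M\,\omega(\delta)\qquad\text{for all } 0<\delta<\delta_0,$$ and let $G$ be an $L_\omega$-extension domain. Let $f=h+\overline{g}$ be a harmonic mapping in $G$, where $g$ and $h$ are analytic functions in $G$. Then $$f\in L_\omega(G)\iff g,\,h\in L_\omega(G)\iff |g|,\,|h|\in L_\omega(G).$$
   Context: A majorant is a continuous increasing function $\omega:[0,\infty)\to[0,\infty)$ with $\omega(0)=0$ such that $\omega(t)/t$ is non-increasing for $t>0$. For $\Omega\subseteq\mathbb{C}$, $L_\omega(\Omega)$ is the set of functions $F:\Omega\to\mathbb{C}$ for which there is a constant $M>0$ with $|F(z)-F(w)|\le M\omega(|z-w|)$ for all $z,w\in\Omega$. $d_G(z)$ is the Euclidean distance from $z\in G$ to $\partial G$. $\mathrm{loc}L_\omega(G)$ is the set of functions $F:G\to\mathbb{C}$ for which there is a fixed constant $M>0$ with $|F(z)-F(w)|\le M\omega(|z-w|)$ whenever $z,w\in G$ and $|z-w|<\frac12 d_G(z)$. A proper subdomain $G$ of $\mathbb{C}$ is called an $L_\omega$-extension domain if $L_\omega(G)=\mathrm{loc}L_\omega(G)$. *)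

(* Defs.v *)
From Stdlib Require Import Reals.
From Coquelicot Require Import Coquelicot.

Local Open Scope R_scope.

(* Functions on a subset of R or C are total functions of which only the
   values on that subset are ever constrained. *)

(* The lower bound 0 <= omega t records that omega maps into [0, oo).
   "Increasing" is in the wide sense, so that e.g. t |-> min t 1 qualifies. *)
Definition is_majorant (omega : R -> R) : Prop :=
  (forall t, 0 <= t -> 0 <= omega t) /\
  continuous_on (fun t => 0 <= t) omega /\
  (forall s t, 0 <= s -> s <= t -> omega s <= omega t) /\
  omega 0 = 0 /\
  (forall s t, 0 < s -> s <= t -> omega t / t <= omega s / s).

(* The integral is improper at 0, and its convergence is part of the
   condition. *)
Definition dini_regular (omega : R -> R) : Prop :=
  exists delta0 M : R, 0 < delta0 /\ 0 < M /\
    forall delta, 0 < delta < delta0 ->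
      exists I : R,
        is_RInt_gen (fun t => omega t / t) (at_right 0) (at_point delta) I /\
        I <= M * omega delta.

Definition Lip (omega : R -> R) (Omega : C -> Prop) (F : C -> C) : Prop :=
  exists M : R, 0 < M /\
    forall z w, Omega z -> Omega w ->
      Cmod (F z - F w)%C <= M * omega (Cmod (z - w)%C).

Definition boundary (G : C -> Prop) (z : C) : Prop :=
  forall eps : posreal,
    (exists u, G u /\ Cmod (u - z)%C < eps) /\
    (exists v, ~ G v /\ Cmod (v - z)%C < eps).

(* [real] collapses infinite values to 0; this never happens for a nonempty
   proper subset G of C, whose boundary is nonempty. *)
Definition dist_boundary (G : C -> Prop) (z : C) : R :=
  real (Glb_Rbar (fun r => exists w, boundary G w /\ r = Cmod (z - w)%C)).

Definition locLip (omega : R -> R) (G : C -> Prop) (F : C -> C) : Prop :=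
  exists M : R, 0 < M /\
    forall z w, G z -> G w -> Cmod (z - w)%C < / 2 * dist_boundary G z ->
      Cmod (F z - F w)%C <= M * omega (Cmod (z - w)%C).

(* Coquelicot's [is_connected] is about intervals of R only. *)
Definition connected (G : C -> Prop) : Prop :=
  forall U V : C -> Prop, open U -> open V ->
    (forall z, G z -> U z \/ V z) ->
    (exists z, G z /\ U z) -> (exists z, G z /\ V z) ->
    exists z, G z /\ U z /\ V z.

Definition proper_subdomain (G : C -> Prop) : Prop :=
  open G /\ connected G /\ (exists z, G z) /\ (exists z, ~ G z).

Definition extension_domain (omega : R -> R) (G : C -> Prop) : Prop :=
  proper_subdomain G /\ forall F : C -> C, Lip omega G F <-> locLip omega G F.

(* [ex_derive] is taken over the field C: complex differentiability. *)
Definition analytic_in (G : C -> Prop) (F : C -> C) : Prop :=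
  forall z, G z -> ex_derive (K := C_AbsRing) (V := C_NormedModule) F z.

Definition modulus (F : C -> C) (z : C) : C := RtoC (Cmod (F z)).

(* Main.v *)
(* If a harmonic function does not exceed its value at the centre of a disc of
   radius r by more than B, its gradient there is at most 2 B / r
   (Borel-Caratheodory). On the disc of radius r = d_G(z) / 2 about a point near
   z this applies, with B a multiple of omega r, to Re (h + g) = Re f and
   Im (h - g) = Im f when f is in L_omega, and to Re (u h) with u h(z) = |h(z)|
   when |h| is in L_omega. Since omega t / t is non-increasing, the resulting
   bound omega r / r on the derivative integrates to the local Lipschitz
   condition, which is the global one on an extension domain. *)
Require Import Defs.
From Stdlib Require Import Reals.
From Coquelicot Require Import Coquelicot.
From Stdlib Require Import Psatz ClassicalEpsilon FunctionalExtensionality.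

Local Open Scope R_scope.

(** Analyticity gives a derivative at every point but no continuity of it, so the derivative bound
    is built up from Goursat's quadrisection argument. The substitution w = z + e^s keeps every
    contour a rectangle: a circle about z becomes a vertical segment of length 2 PI, an annulus
    becomes a rectangle whose horizontal sides cancel by periodicity, and the centre recedes to Re s
    = -oo. Value and derivative at the centre are then read off from the first-order expansion
    there, without any Cauchy formula. Taking only the imaginary part of the contour integral leaves
    integrals of real functions. The hypothesis has to be one-sided, because |h| controls Re (u h)
    from above only. Hence the kernel must be nonnegative on the outer circle: against a kernel of
    changing sign, a one-sided bound would give nothing. *)

(** * Complex derivatives *)

Local Notation is_cderive :=
  (is_derive (K := C_AbsRing) (V := AbsRing_NormedModule C_AbsRing)).

Definition has_cderive (F : C -> C) (z l : C) : Prop :=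
  forall eps : R, 0 < eps -> exists delta : R, 0 < delta /\
    forall w, Cmod (w - z)%C < delta ->
      Cmod (F w - F z - l * (w - z))%C <= eps * Cmod (w - z)%C.

Lemma is_cderive_iff (F : C -> C) (z l : C) :
  is_cderive F z l <-> has_cderive F z l.
Proof.
  split.
  - intros [_ HF] eps Heps.
    destruct (HF z (fun P H => H) (mkposreal eps Heps)) as [d Hd].
    exists d; split; [apply cond_pos|].
    intros w Hw. specialize (Hd w Hw). simpl in Hd.
    rewrite (Cmult_comm l). exact Hd.
  - intros HF; split; [apply is_linear_scal_l|].
    intros x Hx eps.
    apply (is_filter_lim_locally_unique (K := C_AbsRing) (V := AbsRing_NormedModule C_AbsRing)) in Hx. subst x.
    destruct (HF eps (cond_pos eps)) as [d [Hd0 Hd]].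
    exists (mkposreal d Hd0). intros w Hw. specialize (Hd w Hw).
    rewrite (Cmult_comm l) in Hd. exact Hd.
Qed.

(** The product and chain rules are taken over [AbsRing_NormedModule], while [analytic_in] uses
    [C_NormedModule]; the epsilon-delta form is common to both. *)
Lemma analytic_has_cderive (G : C -> Prop) (F : C -> C) (z : C) :
  analytic_in G F -> G z -> exists l, has_cderive F z l.
Proof.
  intros HF Hz. destruct (HF z Hz) as [l [_ Hl]]. exists l.
  intros eps Heps.
  destruct (Hl z (fun P H => H) (mkposreal eps Heps)) as [d Hd].
  exists d; split; [apply cond_pos|].
  intros w Hw. specialize (Hd w Hw). simpl in Hd.
  rewrite (Cmult_comm l). exact Hd.
Qed.

Lemma has_cderive_const (c z : C) : has_cderive (fun _ => c) z 0.
Proof. apply is_cderive_iff, (is_derive_const (K := C_AbsRing) (V := AbsRing_NormedModule C_AbsRing)). Qed.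

Lemma has_cderive_id (z : C) : has_cderive (fun w => w) z 1.
Proof. apply is_cderive_iff, (is_derive_id (K := C_AbsRing)). Qed.

Lemma has_cderive_plus (F1 F2 : C -> C) (z l1 l2 : C) :
  has_cderive F1 z l1 -> has_cderive F2 z l2 ->
  has_cderive (fun w => F1 w + F2 w)%C z (l1 + l2).
Proof.
  intros H1 H2. apply is_cderive_iff in H1, H2. apply is_cderive_iff.
  exact (is_derive_plus (K := C_AbsRing) (V := AbsRing_NormedModule C_AbsRing) _ _ _ _ _ H1 H2).
Qed.

Lemma has_cderive_mult (F1 F2 : C -> C) (z l1 l2 : C) :
  has_cderive F1 z l1 -> has_cderive F2 z l2 ->
  has_cderive (fun w => F1 w * F2 w)%C z (l1 * F2 z + F1 z * l2).
Proof.
  intros H1 H2. apply is_cderive_iff in H1, H2. apply is_cderive_iff.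
  exact (is_derive_mult (K := C_AbsRing) _ _ _ _ _ H1 H2 Cmult_comm).
Qed.

Lemma has_cderive_comp (F1 F2 : C -> C) (z l1 l2 : C) :
  has_cderive F1 (F2 z) l1 -> has_cderive F2 z l2 ->
  has_cderive (fun w => F1 (F2 w)) z (l2 * l1).
Proof.
  intros H1 H2. apply is_cderive_iff in H1, H2. apply is_cderive_iff.
  exact (is_derive_comp (K := C_AbsRing) (V := AbsRing_NormedModule C_AbsRing) _ _ _ _ _ H1 H2).
Qed.

Lemma has_cderive_scal (c : C) (F : C -> C) (z l : C) :
  has_cderive F z l -> has_cderive (fun w => c * F w)%C z (c * l).
Proof.
  intros H. replace (c * l)%C with (0 * F z + c * l)%C by ring.
  exact (has_cderive_mult (fun _ => c) F z 0 l (has_cderive_const c z) H).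
Qed.

(** * The complex exponential *)

Definition Cexp (z : C) : C := (exp (Re z) * cos (Im z), exp (Re z) * sin (Im z)).

Lemma Cexp_plus (z w : C) : Cexp (z + w) = (Cexp z * Cexp w)%C.
Proof.
  destruct z as [x y], w as [x' y'].
  apply injective_projections; simpl; rewrite exp_plus, ?cos_plus, ?sin_plus; ring.
Qed.

Lemma Cexp_0 : Cexp 0 = 1.
Proof. apply injective_projections; simpl; rewrite exp_0, ?cos_0, ?sin_0; ring. Qed.

Lemma Cexp_opp (z : C) : (Cexp z * Cexp (- z))%C = 1.
Proof. rewrite <- Cexp_plus. replace (z + - z)%C with (RtoC 0) by ring. apply Cexp_0. Qed.

Lemma Cmod_Cexp (z : C) : Cmod (Cexp z) = exp (Re z).
Proof.
  unfold Cmod; simpl.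
  transitivity (sqrt (Rsqr (exp (Re z)))); [|apply sqrt_Rsqr, Rlt_le, exp_pos].
  apply f_equal.
  transitivity (Rsqr (exp (Re z)) * (Rsqr (sin (Im z)) + Rsqr (cos (Im z)))).
  - unfold Rsqr; ring.
  - rewrite sin2_cos2; ring.
Qed.

Lemma Cmod_le_Re_Im (z : C) : Cmod z <= Rabs (Re z) + Rabs (Im z).
Proof.
  replace (Cmod z) with (Cmod (RtoC (Re z) + Ci * RtoC (Im z))%C).
  2:{ f_equal. apply injective_projections; simpl; unfold Re, Im; ring. }
  eapply Rle_trans; [apply Cmod_triangle|].
  rewrite Cmod_mult, Cmod_Ci, !Cmod_R. lra.
Qed.

Lemma im_le_Cmod (z : C) : Rabs (Im z) <= Cmod z.
Proof. eapply Rle_trans; [apply Rmax_r|apply Rmax_Cmod]. Qed.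

Lemma derive_eps (f : R -> R) (l : R) :
  is_derive f 0 l -> forall eps, 0 < eps -> exists delta, 0 < delta /\
    forall h, Rabs h < delta -> Rabs (f h - f 0 - l * h) <= eps * Rabs h.
Proof.
  intros [_ Hf] eps Heps.
  destruct (Hf 0 (fun P H => H) (mkposreal eps Heps)) as [d Hd].
  exists d; split; [apply cond_pos|].
  intros h Hh. 
  assert (Hb : ball (M := AbsRing_UniformSpace R_AbsRing) 0 d h).
  { change (Rabs (h - 0) < d). rewrite Rminus_0_r. exact Hh. }
  specialize (Hd h Hb). 
  change (Rabs (f h - f 0 - (h - 0) * l) <= eps * Rabs (h - 0)) in Hd.
  rewrite Rminus_0_r, (Rmult_comm h l) in Hd. exact Hd.
Qed.

(** The linearisation errors of [exp], [cos] and [sin] at 0 combine to that of [Cexp]; the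
    functional equation later moves the derivative to any point. *)
Lemma has_cderive_Cexp_0 : has_cderive Cexp 0 1.
Proof.
  intros eps Heps.
  (* The error is at most [4 * (e * m)] in the real part and [5 * (e * m)] in the imaginary part,
     whence 9. The bound 1 keeps [exp x] below 3. *)
  set (e := Rmin (eps / 9) 1).
  assert (He : 0 < e) by (apply Rmin_glb_lt; lra).
  assert (He1 : e <= 1) by apply Rmin_r.
  assert (He2 : e <= eps / 9) by apply Rmin_l.
  assert (Dexp : is_derive exp 0 1).
  { replace 1 with (exp 0) by apply exp_0. apply is_derive_exp. }
  assert (Dcos : is_derive cos 0 0).
  { auto_derive; trivial. rewrite sin_0; ring. }
  assert (Dsin : is_derive sin 0 1).
  { auto_derive; trivial. rewrite cos_0; ring. }
  destruct (derive_eps _ _ Dexp e He) as [d1 [Hd1 H1]].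
  destruct (derive_eps _ _ Dcos e He) as [d2 [Hd2 H2]].
  destruct (derive_eps _ _ Dsin e He) as [d3 [Hd3 H3]].
  exists (Rmin (Rmin d1 e) (Rmin d2 d3)); split.
  { repeat apply Rmin_glb_lt; lra. }
  intros w Hw. replace (w - 0)%C with w in * by ring.
  assert (Cmod w < d1 /\ Cmod w < e /\ Cmod w < d2 /\ Cmod w < d3) as (Hw1 & Hwe & Hw2 & Hw3).
  { assert (A := Rmin_l (Rmin d1 e) (Rmin d2 d3)). assert (B := Rmin_r (Rmin d1 e) (Rmin d2 d3)).
    assert (A1 := Rmin_l d1 e). assert (A2 := Rmin_r d1 e).
    assert (B1 := Rmin_l d2 d3). assert (B2 := Rmin_r d2 d3). lra. }
  assert (Hx := re_le_Cmod w). assert (Hy := im_le_Cmod w).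
  destruct w as [x y]. simpl in Hx, Hy. set (m := Cmod (x, y)) in *.
  assert (Hm := Cmod_ge_0 (x, y)). fold m in Hm.
  rewrite Cexp_0.
  assert (K1 := H1 x (Rle_lt_trans _ _ _ Hx Hw1)).
  assert (K2 := H2 y (Rle_lt_trans _ _ _ Hy Hw2)).
  assert (K3 := H3 y (Rle_lt_trans _ _ _ Hy Hw3)).
  rewrite exp_0 in K1. rewrite cos_0 in K2. rewrite sin_0 in K3.
  assert (L1 : Rabs (exp x - 1 - 1 * x) <= e * m) by nra.
  assert (L2 : Rabs (cos y - 1 - 0 * y) <= e * m) by nra.
  assert (L3 : Rabs (sin y - 0 - 1 * y) <= e * m) by nra.
  apply Rabs_le_between in L1, L2, L3, Hx, Hy.
  eapply Rle_trans; [apply Cmod_le_Re_Im|]. 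
  unfold Cexp, Cminus, Cplus, Copp, Cmult, RtoC; simpl.
  assert (E2 := exp_pos x).
  assert (E1 : exp x <= 3) by nra.
  assert (E3 : Rabs (exp x - 1) <= 2 * m) by (apply Rabs_le_between; nra).
  apply Rabs_le_between in E3.
  assert (M1 : m * m <= e * m) by nra.
  apply Rle_trans with (4 * (e * m) + 5 * (e * m)); [|nra].
  apply Rplus_le_compat; apply Rabs_le_between.
  - replace (exp x * cos y + - (1) + - (1 * (x + - 0) - 0 * (y + - 0)))
      with (exp x * (cos y - 1 - 0 * y) + (exp x - 1 - 1 * x)) by ring.
    nra.
  - replace (exp x * sin y + - 0 + - (1 * (y + - 0) + 0 * (x + - 0)))
      with (exp x * (sin y - 0 - 1 * y) + (exp x - 1) * y) by ring.
    assert (Rabs ((exp x - 1) * y) <= 2 * m * m).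
    { rewrite Rabs_mult. apply Rmult_le_compat; try apply Rabs_pos; apply Rabs_le_between; lra. }
    assert (Q := Rle_abs ((exp x - 1) * y)). assert (Q' := Rle_abs (- ((exp x - 1) * y))).
    rewrite Rabs_Ropp in Q'.
    assert (Rabs (exp x * (sin y - 0 - 1 * y)) <= 3 * (e * m)).
    { rewrite Rabs_mult, (Rabs_pos_eq (exp x)) by lra.
      apply Rmult_le_compat; try lra; [apply Rabs_pos|apply Rabs_le_between; lra]. }
    assert (P := Rle_abs (exp x * (sin y - 0 - 1 * y))). assert (P' := Rle_abs (- (exp x * (sin y - 0 - 1 * y)))).
    rewrite Rabs_Ropp in P'. split; lra.
Qed.

Lemma has_cderive_Cexp (z : C) : has_cderive Cexp z (Cexp z).
Proof.
  intros eps Heps.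
  assert (Hp : 0 < Cmod (Cexp z)) by (rewrite Cmod_Cexp; apply exp_pos).
  destruct (has_cderive_Cexp_0 (eps / Cmod (Cexp z))) as [d [Hd H]].
  { apply Rdiv_lt_0_compat; assumption. }
  exists d; split; [exact Hd|]. intros w Hw.
  specialize (H (w - z)%C). replace (w - z - 0)%C with (w - z)%C in H by ring.
  specialize (H Hw). rewrite Cexp_0 in H.
  replace (Cexp w) with (Cexp z * Cexp (w - z))%C.
  2:{ rewrite <- Cexp_plus. f_equal. ring. }
  replace (Cexp z * Cexp (w - z) - Cexp z - Cexp z * (w - z))%C
    with (Cexp z * (Cexp (w - z) - 1 - 1 * (w - z)))%C by ring.
  rewrite Cmod_mult.
  apply Rle_trans with (Cmod (Cexp z) * (eps / Cmod (Cexp z) * Cmod (w - z)%C)).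
  - apply Rmult_le_compat_l; lra.
  - right. field. lra.
Qed.

(** * Contour integrals around rectangles *)

Lemma has_cderive_continuous (F : C -> C) (z l : C) :
  has_cderive F z l -> forall eps, 0 < eps -> exists delta, 0 < delta /\
    forall w, Cmod (w - z)%C < delta -> Cmod (F w - F z)%C < eps.
Proof.
  intros H eps Heps. destruct (H 1 Rlt_0_1) as [d [Hd Hd']].
  assert (Hl := Cmod_ge_0 l).
  exists (Rmin d (eps / (1 + Cmod l + 1))); split.
  { apply Rmin_glb_lt; [lra|apply Rdiv_lt_0_compat; lra]. }
  intros w Hw.
  assert (A := Rmin_l d (eps / (1 + Cmod l + 1))). assert (B := Rmin_r d (eps / (1 + Cmod l + 1))).
  specialize (Hd' w (Rlt_le_trans _ _ _ Hw A)).
  replace (F w - F z)%C with (F w - F z - l * (w - z) + l * (w - z))%C by ring.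
  eapply Rle_lt_trans; [apply Cmod_triangle|]. rewrite (Cmod_mult l).
  assert (Cmod (w - z)%C * (1 + Cmod l + 1) < eps).
  { apply Rlt_div_r; lra. }
  assert (Q := Cmod_ge_0 (w - z)%C). nra.
Qed.

(** Here [p] stands for [Re] or [Im] and [gamma] for a horizontal or vertical line. *)
Lemma continuous_cderive_path (p : C -> R) (F : C -> C) (gamma : R -> C) (t : R) (l : C) :
  (forall u v, Rabs (p u - p v) <= Cmod (u - v)%C) ->
  (forall s, Cmod (gamma s - gamma t)%C <= Rabs (s - t)) ->
  has_cderive F (gamma t) l -> continuous (fun s => p (F (gamma s))) t.
Proof.
  intros Hp Hgamma HF. apply filterlim_locally. intros eps.
  destruct (has_cderive_continuous _ _ _ HF eps (cond_pos eps)) as [d [Hd H]].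
  exists (mkposreal d Hd). intros s Hs.
  change (Rabs (p (F (gamma s)) - p (F (gamma t))) < eps).
  eapply Rle_lt_trans; [apply Hp|]. apply H.
  eapply Rle_lt_trans; [apply Hgamma|exact Hs].
Qed.

Lemma Re_contraction (u v : C) : Rabs (Re u - Re v) <= Cmod (u - v)%C.
Proof. exact (re_le_Cmod (u - v)%C). Qed.

Lemma Im_contraction (u v : C) : Rabs (Im u - Im v) <= Cmod (u - v)%C.
Proof. exact (im_le_Cmod (u - v)%C). Qed.

Lemma horizontal_path (y x s : R) : Cmod ((s, y) - (x, y))%C <= Rabs (s - x).
Proof.
  eapply Rle_trans; [apply Cmod_le_Re_Im|]. simpl.
  replace (y + - y) with 0 by ring. rewrite Rabs_R0. unfold Rminus. lra.
Qed.

Lemma vertical_path (x y s : R) : Cmod ((x, s) - (x, y))%C <= Rabs (s - y).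
Proof.
  eapply Rle_trans; [apply Cmod_le_Re_Im|]. simpl.
  replace (x + - x) with 0 by ring. rewrite Rabs_R0. unfold Rminus. lra.
Qed.

(* The imaginary part of the contour integral of [H] around [a,b] x [c,d]. *)
Definition rect_int (H : C -> C) (a b c d : R) : R :=
  RInt (fun x => Im (H (x, c)) - Im (H (x, d))) a b +
  RInt (fun y => Re (H (b, y)) - Re (H (a, y))) c d.

Definition holo_on_rect (H : C -> C) (a b c d : R) : Prop :=
  forall x y, a <= x <= b -> c <= y <= d -> exists l, has_cderive H (x, y) l.

Lemma holo_on_rect_sub (H : C -> C) (a b c d a' b' c' d' : R) :
  holo_on_rect H a b c d -> a <= a' -> b' <= b -> c <= c' -> d' <= d ->
  holo_on_rect H a' b' c' d'.
Proof. intros HH ? ? ? ? x y Hx Hy. apply HH; lra. Qed.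

Lemma ex_RInt_horizontal (H : C -> C) (a b c d y : R) :
  holo_on_rect H a b c d -> a <= b -> c <= y <= d ->
  ex_RInt (fun x => Im (H (x, y))) a b.
Proof.
  intros HH Hab Hy. apply (ex_RInt_continuous (V := R_CompleteNormedModule)).
  intros x Hx. rewrite Rmin_left, Rmax_right in Hx by lra.
  destruct (HH x y Hx Hy) as [l Hl].
  apply (continuous_cderive_path Im H (fun x => (x, y)) x l Im_contraction); [|exact Hl].
  intros s; apply horizontal_path.
Qed.

Lemma ex_RInt_vertical (H : C -> C) (a b c d x : R) :
  holo_on_rect H a b c d -> c <= d -> a <= x <= b ->
  ex_RInt (fun y => Re (H (x, y))) c d.
Proof.
  intros HH Hab Hx. apply (ex_RInt_continuous (V := R_CompleteNormedModule)).
  intros y Hy. rewrite Rmin_left, Rmax_right in Hy by lra.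
  destruct (HH x y Hx Hy) as [l Hl].
  apply (continuous_cderive_path Re H (fun y => (x, y)) y l Re_contraction); [|exact Hl].
  intros s; apply vertical_path.
Qed.

(** Pairing opposite sides, as in [rect_int], suits the local estimate, where differences across the
    rectangle are small; separate sides suit subdivision and periodicity. *)
Lemma rect_int_sides (H : C -> C) (a b c d : R) :
  holo_on_rect H a b c d -> a <= b -> c <= d ->
  rect_int H a b c d =
    RInt (fun x => Im (H (x, c))) a b - RInt (fun x => Im (H (x, d))) a b +
    (RInt (fun y => Re (H (b, y))) c d - RInt (fun y => Re (H (a, y))) c d).
Proof.
  intros HH Hab Hcd. unfold rect_int.
  rewrite (RInt_minus (V := R_CompleteNormedModule) (fun x => Im (H (x, c))) (fun x => Im (H (x, d)))).
  2,3: eapply ex_RInt_horizontal; try exact HH; lra.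
  rewrite (RInt_minus (V := R_CompleteNormedModule) (fun y => Re (H (b, y))) (fun y => Re (H (a, y)))).
  2,3: eapply ex_RInt_vertical; try exact HH; lra.
  reflexivity.
Qed.

(** Each inner edge is shared by two pieces, which traverse it in opposite directions. *)
Lemma rect_int_split (H : C -> C) (a m b c n d : R) :
  holo_on_rect H a b c d -> a <= m <= b -> c <= n <= d ->
  rect_int H a b c d =
    rect_int H a m c n + rect_int H m b c n + rect_int H a m n d + rect_int H m b n d.
Proof.
  intros HH Hm Hn.
  assert (Hh : forall y, c <= y <= d ->
    RInt (fun x => Im (H (x, y))) a m + RInt (fun x => Im (H (x, y))) m b =
    RInt (fun x => Im (H (x, y))) a b).
  { intros y Hy. apply (RInt_Chasles (V := R_CompleteNormedModule));
      apply (ex_RInt_horizontal H _ _ c d); try lra;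
      apply (holo_on_rect_sub H a b c d); try exact HH; lra. }
  assert (Hv : forall x, a <= x <= b ->
    RInt (fun y => Re (H (x, y))) c n + RInt (fun y => Re (H (x, y))) n d =
    RInt (fun y => Re (H (x, y))) c d).
  { intros x Hx. apply (RInt_Chasles (V := R_CompleteNormedModule));
      apply (ex_RInt_vertical H a b); try lra;
      apply (holo_on_rect_sub H a b c d); try exact HH; lra. }
  assert (Hsub : forall a' b' c' d', a <= a' -> b' <= b -> c <= c' -> d' <= d ->
    holo_on_rect H a' b' c' d').
  { intros. eapply holo_on_rect_sub; eassumption. }
  rewrite (rect_int_sides H a b c d), (rect_int_sides H a m c n),
    (rect_int_sides H m b c n), (rect_int_sides H a m n d), (rect_int_sides H m b n d)
    by (try apply Hsub; lra).
  rewrite <- (Hh c), <- (Hh d), <- (Hv a), <- (Hv b) by lra. ring.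
Qed.

(* For an affine [H] the two integrands are constant and cancel. *)
Lemma rect_int_local (H : C -> C) (a b c d : R) (z l : C) (eps : R) :
  holo_on_rect H a b c d -> a <= b -> c <= d -> 0 <= eps ->
  a <= Re z <= b -> c <= Im z <= d ->
  (forall w, a <= Re w <= b -> c <= Im w <= d ->
    Cmod (H w - H z - l * (w - z))%C <= eps * Cmod (w - z)%C) ->
  Rabs (rect_int H a b c d) <= 2 * eps * (b - a + (d - c)) ^ 2.
Proof.
  intros HH Hab Hcd Heps Hzx Hzy Hl.
  assert (Herr : forall w, a <= Re w <= b -> c <= Im w <= d ->
    Cmod (H w - H z - l * (w - z))%C <= eps * (b - a + (d - c))).
  { intros w Hwx Hwy. eapply Rle_trans; [apply Hl; assumption|].
    apply Rmult_le_compat_l; [exact Heps|].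
    eapply Rle_trans; [apply Cmod_le_Re_Im|].
    apply Rplus_le_compat; apply Rabs_le_between.
    - change (Re (w - z)%C) with (Re w - Re z). lra.
    - change (Im (w - z)%C) with (Im w - Im z). lra. }
  assert (Hdiff : forall w w', a <= Re w <= b -> c <= Im w <= d ->
    a <= Re w' <= b -> c <= Im w' <= d ->
    Cmod (H w - H w' - l * (w - w'))%C <= 2 * (eps * (b - a + (d - c)))).
  { intros w w' ? ? ? ?.
    replace (H w - H w' - l * (w - w'))%C
      with ((H w - H z - l * (w - z)) + - (H w' - H z - l * (w' - z)))%C by ring.
    eapply Rle_trans; [apply Cmod_triangle|]. rewrite Cmod_opp.
    assert (A := Herr w); assert (B := Herr w'). lra. }
  set (S := b - a + (d - c)) in *.
  (* For points facing each other on the horizontal sides, [w - w'] is i (c - d), so the affine part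
     contributes [Re l * (c - d)]. *)
  assert (I1 : Rabs (RInt (fun x => Im (H (x, c)) - Im (H (x, d)) - Re l * (c - d)) a b)
    <= (b - a) * (2 * (eps * S))).
  { apply abs_RInt_le_const; [exact Hab| |].
    - apply (ex_RInt_minus (V := R_NormedModule)); [|apply ex_RInt_const].
      apply (ex_RInt_minus (V := R_NormedModule)); eapply ex_RInt_horizontal; try exact HH; lra.
    - intros x Hx. eapply Rle_trans; [|apply (Hdiff (x, c) (x, d)); simpl; lra].
      eapply Rle_trans; [|apply im_le_Cmod]. right. f_equal. simpl. unfold Re, Im. ring. }
  assert (I2 : Rabs (RInt (fun y => Re (H (b, y)) - Re (H (a, y)) - Re l * (b - a)) c d)
    <= (d - c) * (2 * (eps * S))).
  { apply abs_RInt_le_const; [exact Hcd| |].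
    - apply (ex_RInt_minus (V := R_NormedModule)); [|apply ex_RInt_const].
      apply (ex_RInt_minus (V := R_NormedModule)); eapply ex_RInt_vertical; try exact HH; lra.
    - intros y Hy. eapply Rle_trans; [|apply (Hdiff (b, y) (a, y)); simpl; lra].
      eapply Rle_trans; [|apply re_le_Cmod]. right. f_equal. simpl. unfold Re, Im. ring. }
  rewrite (RInt_minus (V := R_CompleteNormedModule) (fun x => Im (H (x, c)) - Im (H (x, d)))) in I1.
  2: apply (ex_RInt_minus (V := R_NormedModule)); eapply ex_RInt_horizontal; try exact HH; lra.
  2: apply ex_RInt_const.
  rewrite (RInt_minus (V := R_CompleteNormedModule) (fun y => Re (H (b, y)) - Re (H (a, y)))) in I2.
  2: apply (ex_RInt_minus (V := R_NormedModule)); eapply ex_RInt_vertical; try exact HH; lra.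
  2: apply ex_RInt_const.
  rewrite RInt_const in I1, I2.
  unfold rect_int.
  set (J1 := RInt (fun x => Im (H (x, c)) - Im (H (x, d))) a b) in *.
  set (J2 := RInt (fun y => Re (H (b, y)) - Re (H (a, y))) c d) in *.
  change (Rabs (J1 - (b - a) * (Re l * (c - d))) <= (b - a) * (2 * (eps * S))) in I1.
  change (Rabs (J2 - (d - c) * (Re l * (b - a))) <= (d - c) * (2 * (eps * S))) in I2.
  replace (J1 + J2) with ((J1 - (b - a) * (Re l * (c - d))) + (J2 - (d - c) * (Re l * (b - a)))) by ring.
  eapply Rle_trans; [apply Rabs_triang|]. unfold S in *. nra.
Qed.

(** * Goursat's theorem by quadrisection *)

(** A left end that moves by at most half the current length keeps the halved interval inside the
    old one. So every right end bounds all left ends, and the supremum of the left ends lies in all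
    intervals. *)
Lemma nested_point (u : nat -> R) (s : R) :
  0 <= s ->
  (forall n, u n <= u (S n) <= u n + s / 2 ^ S n) ->
  exists x, forall n, u n <= x <= u n + s / 2 ^ n.
Proof.
  intros Hs Hu.
  assert (Hpow : forall n, 0 < 2 ^ n) by (intros; apply pow_lt; lra).
  assert (Hhalf : forall n, s / 2 ^ n = s / 2 ^ S n + s / 2 ^ S n).
  { intros n. simpl. field. apply Rgt_not_eq, Hpow. }
  assert (Hmon : forall n k, u n <= u (n + k)%nat /\ u (n + k)%nat + s / 2 ^ (n + k) <= u n + s / 2 ^ n).
  { intros n; induction k as [|k IH].
    - rewrite Nat.add_0_r. lra.
    - rewrite Nat.add_succ_r. specialize (Hu (n + k)%nat). specialize (Hhalf (n + k)%nat). lra. }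
  assert (Hle : forall n m, u m <= u n + s / 2 ^ n).
  { intros n m. destruct (Nat.le_ge_cases n m) as [H|H].
    - replace m with (n + (m - n))%nat by lia.
      destruct (Hmon n (m - n)%nat) as [_ A].
      assert (0 <= s / 2 ^ (n + (m - n))) by (apply Rmult_le_pos; [lra|apply Rlt_le, Rinv_0_lt_compat, Hpow]). lra.
    - destruct (Hmon m (n - m)%nat) as [A _]. replace (m + (n - m))%nat with n in A by lia.
      assert (0 <= s / 2 ^ n) by (apply Rmult_le_pos; [lra|apply Rlt_le, Rinv_0_lt_compat, Hpow]). lra. }
  destruct (completeness (fun x => exists n, x = u n)) as [x [Hub Hlub]].
  - exists (u 0%nat + s / 2 ^ 0). intros x [n ->]. apply Hle.
  - exists (u 0%nat), 0%nat. reflexivity.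
  - exists x. intros n. split.
    + apply Hub. exists n; reflexivity.
    + apply Hlub. intros y [m ->]. apply Hle.
Qed.

(** A rectangle violating the bound contains a quarter violating it with the same [eps]. The
    violating rectangles shrink to a point, where differentiability contradicts them. *)
Lemma goursat_bound (H : C -> C) (a c p q eps : R) :
  0 <= p -> 0 <= q -> 0 < eps -> holo_on_rect H a (a + p) c (c + q) ->
  Rabs (rect_int H a (a + p) c (c + q)) <= eps * (p + q) ^ 2.
Proof.
  intros Hp Hq Heps HH.
  assert (Hpow : forall n, 0 < 2 ^ n) by (intros; apply pow_lt; lra).
  pose (P := fun n => p / 2 ^ n). pose (Q := fun n => q / 2 ^ n).
  assert (HP : forall n, P n = P (S n) + P (S n)).
  { intros n. unfold P; simpl. field. apply Rgt_not_eq, Hpow. }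
  assert (HQ : forall n, Q n = Q (S n) + Q (S n)).
  { intros n. unfold Q; simpl. field. apply Rgt_not_eq, Hpow. }
  assert (HP0 : forall n, 0 <= P n).
  { intros n. apply Rmult_le_pos; [lra|apply Rlt_le, Rinv_0_lt_compat, Hpow]. }
  assert (HQ0 : forall n, 0 <= Q n).
  { intros n. apply Rmult_le_pos; [lra|apply Rlt_le, Rinv_0_lt_compat, Hpow]. }
  assert (P0 : P 0%nat = p) by (unfold P; simpl; field).
  assert (Q0 : Q 0%nat = q) by (unfold Q; simpl; field).
  apply Rnot_lt_le. intros Hbad0.
  pose (inside := fun n s => a <= fst s /\ fst s + P n <= a + p /\ c <= snd s /\ snd s + Q n <= c + q).
  pose (bad := fun n s => inside n s /\
    eps * (P n + Q n) ^ 2 < Rabs (rect_int H (fst s) (fst s + P n) (snd s) (snd s + Q n))).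
  assert (Hstep : forall n s, bad n s -> exists s', bad (S n) s' /\
    fst s <= fst s' <= fst s + P (S n) /\ snd s <= snd s' <= snd s + Q (S n)).
  { intros n [x y] [Hin Hbad]. unfold inside in Hin. cbn [fst snd] in Hin, Hbad.
    specialize (HP0 (S n)); specialize (HQ0 (S n)). specialize (HP n). specialize (HQ n).
    assert (In : forall s', (fst s' = x \/ fst s' = x + P (S n)) ->
      (snd s' = y \/ snd s' = y + Q (S n)) -> inside (S n) s' /\
      x <= fst s' <= x + P (S n) /\ y <= snd s' <= y + Q (S n)).
    { unfold inside. intros s' [-> | ->] [-> | ->]; lra. }
    apply NNPP. intros Hno.
    (* If no quarter were bad, the four bounds would add up to the bound at level [n], as halving
       both sides divides the square by 4. *)
    assert (Hgood : forall s', (fst s' = x \/ fst s' = x + P (S n)) ->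
      (snd s' = y \/ snd s' = y + Q (S n)) ->
      Rabs (rect_int H (fst s') (fst s' + P (S n)) (snd s') (snd s' + Q (S n))) <=
        eps * (P (S n) + Q (S n)) ^ 2).
    { intros s' H1 H2. apply Rnot_lt_le. intros H3. apply Hno. exists s'.
      destruct (In s' H1 H2) as [I J]. exact (conj (conj I H3) J). }
    rewrite (rect_int_split H x (x + P (S n)) (x + P n) y (y + Q (S n)) (y + Q n)) in Hbad by
      (try (apply (holo_on_rect_sub H a (a + p) c (c + q)); [exact HH|..]); lra).
    assert (G1 := Hgood (x, y)). assert (G2 := Hgood (x + P (S n), y)).
    assert (G3 := Hgood (x, y + Q (S n))). assert (G4 := Hgood (x + P (S n), y + Q (S n))).
    cbn [fst snd] in G1, G2, G3, G4.
    replace (x + P (S n) + P (S n)) with (x + P n) in * by lra.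
    replace (y + Q (S n) + Q (S n)) with (y + Q n) in * by lra.
    specialize (G1 (or_introl eq_refl) (or_introl eq_refl)).
    specialize (G2 (or_intror eq_refl) (or_introl eq_refl)).
    specialize (G3 (or_introl eq_refl) (or_intror eq_refl)).
    specialize (G4 (or_intror eq_refl) (or_intror eq_refl)).
    revert Hbad. apply Rle_not_lt.
    eapply Rle_trans; [eapply Rle_trans; [apply Rabs_triang|apply Rplus_le_compat_r];
      eapply Rle_trans; [apply Rabs_triang|apply Rplus_le_compat_r; apply Rabs_triang]|].
    replace (eps * (P n + Q n) ^ 2) with (4 * (eps * (P (S n) + Q (S n)) ^ 2))
      by (rewrite HP, HQ; ring).
    lra. }
  assert (Hstart : bad 0%nat (a, c)).
  { unfold bad, inside; cbn [fst snd]. rewrite P0, Q0. repeat split; try lra. }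
  (* The lower left corners, each carried with its proof of badness, which the choice of the next
     one needs. *)
  pose (seq := fix seq n : {s | bad n s} :=
    match n with
    | O => exist (bad 0%nat) (a, c) Hstart
    | S n => let s := seq n in
        let s' := constructive_indefinite_description _ (Hstep n (proj1_sig s) (proj2_sig s)) in
        exist (bad (S n)) (proj1_sig s') (proj1 (proj2_sig s'))
    end).
  assert (Hseq : forall n, fst (proj1_sig (seq n)) <= fst (proj1_sig (seq (S n))) <= fst (proj1_sig (seq n)) + P (S n) /\
    snd (proj1_sig (seq n)) <= snd (proj1_sig (seq (S n))) <= snd (proj1_sig (seq n)) + Q (S n)).
  { intros n. simpl. destruct (constructive_indefinite_description _ _) as [s' Hs']. simpl. apply Hs'. }
  destruct (nested_point (fun n => fst (proj1_sig (seq n))) p Hp (fun n => proj1 (Hseq n))) as [x Hx].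
  destruct (nested_point (fun n => snd (proj1_sig (seq n))) q Hq (fun n => proj2 (Hseq n))) as [y Hy].
  assert (Hin : forall n, bad n (proj1_sig (seq n))) by (intros n; apply (proj2_sig (seq n))).
  clearbody seq.
  destruct (HH x y) as [l Hl].
  { destruct (Hin 0%nat) as [I0 _]. unfold inside in I0. specialize (Hx 0%nat). simpl in Hx. lra. }
  { destruct (Hin 0%nat) as [I0 _]. unfold inside in I0. specialize (Hy 0%nat). simpl in Hy. lra. }
  (* Half of [eps] makes up for the factor 2 in [rect_int_local]. *)
  destruct (Hl (eps / 2)) as [d [Hd Hloc]]; [lra|].
  (* The 1 added to [p + q] allows for a rectangle reduced to a point. *)
  destruct (pow_lt_1_zero (/ 2)) with (y := d / (p + q + 1)) as [n Hn].
  { rewrite Rabs_pos_eq; lra. }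
  { apply Rdiv_lt_0_compat; lra. }
  specialize (Hn n (le_n n)).
  rewrite Rabs_pos_eq in Hn by (apply pow_le; lra). rewrite pow_inv in Hn.
  assert (Hsmall : P n + Q n < d).
  { apply Rlt_div_r in Hn; [|lra]. unfold P, Q, Rdiv. 
    assert (0 < / 2 ^ n) by apply Rinv_0_lt_compat, Hpow. nra. }
  specialize (Hx n). specialize (Hy n). destruct (Hin n) as [I0 Hbad]. unfold inside in I0.
  fold (P n) in Hx. fold (Q n) in Hy.
  destruct (proj1_sig (seq n)) as [x0 y0]. cbn [fst snd] in *.
  revert Hbad. apply Rle_not_lt.
  eapply Rle_trans.
  - apply (rect_int_local H _ _ _ _ (x, y) l (eps / 2)); simpl; try lra.
    + apply (holo_on_rect_sub H a (a + p) c (c + q)); [exact HH|..]; lra.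
    + intros w Hwx Hwy. apply Hloc.
      eapply Rle_lt_trans; [apply Cmod_le_Re_Im|].
      eapply Rle_lt_trans; [|exact Hsmall].
      apply Rplus_le_compat; apply Rabs_le_between.
      * change (Re (w - (x, y))%C) with (Re w - x). lra.
      * change (Im (w - (x, y))%C) with (Im w - y). lra.
  - right. field.
Qed.

Lemma goursat (H : C -> C) (a b c d : R) :
  a <= b -> c <= d -> holo_on_rect H a b c d -> rect_int H a b c d = 0.
Proof.
  intros Hab Hcd HH.
  destruct (Req_dec (rect_int H a b c d) 0) as [E|E]; [exact E|exfalso].
  apply Rabs_pos_lt in E.
  assert (K : 0 <= (b - a + (d - c)) ^ 2) by apply pow2_ge_0.
  (* With k the square of the half perimeter, this [eps] bounds the integral's absolute value v by v
     k / (2 (k + 1)), which is less than v. *)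
  assert (B := goursat_bound H a c (b - a) (d - c)
    (Rabs (rect_int H a b c d) / (2 * ((b - a + (d - c)) ^ 2 + 1)))).
  replace (a + (b - a)) with b in B by ring. replace (c + (d - c)) with d in B by ring.
  assert (0 < Rabs (rect_int H a b c d) / (2 * ((b - a + (d - c)) ^ 2 + 1))) by (apply Rdiv_lt_0_compat; lra).
  specialize (B ltac:(lra) ltac:(lra) H0 HH).
  revert B. apply Rlt_not_le.
  set (v := Rabs _) in *. set (k := (_ ^ 2)) in *.
  apply Rmult_lt_reg_r with (2 * (k + 1)); [lra|].
  replace (v / (2 * (k + 1)) * k * (2 * (k + 1))) with (v * k) by (field; lra).
  nra.
Qed.

(** * The Borel-Caratheodory inequality *)

Lemma periodic_mean_constant (H : C -> C) (a b T : R) :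
  a <= b -> 0 <= T -> holo_on_rect H a b 0 T ->
  (forall x, H (x, T) = H (x, 0)) ->
  RInt (fun y => Re (H (a, y))) 0 T = RInt (fun y => Re (H (b, y))) 0 T.
Proof.
  intros Hab HT HH Hper.
  assert (E := goursat H a b 0 T Hab HT HH).
  rewrite rect_int_sides in E by assumption.
  rewrite (RInt_ext (fun x => Im (H (x, T))) (fun x => Im (H (x, 0)))) in E.
  - lra.
  - intros x _. rewrite Hper. reflexivity.
Qed.

(** This is the pole term of the integrand near the centre. Its size grows like e^-a as a tends to
    -oo, so it has to be integrated exactly and cannot be estimated. *)
Lemma is_RInt_Re_Cexp_period (k : C) (a : R) :
  is_RInt (fun y => Re (k * Cexp (- (a, y)))%C) 0 (2 * PI) 0.
Proof.
  pose (f := fun y => exp (- a) * (Re k * sin y - Im k * cos y)).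
  replace 0 with (minus (f (2 * PI)) (f 0)) at 2.
  2:{ unfold f. rewrite sin_2PI, cos_2PI, sin_0, cos_0. apply Rminus_diag_eq. reflexivity. }
  apply (is_RInt_ext (fun y => exp (- a) * (Re k * cos y + Im k * sin y))).
  { intros y _. rewrite re_mult. unfold Cexp; simpl. rewrite cos_neg, sin_neg. ring. }
  apply (is_RInt_derive (V := R_CompleteNormedModule)).
  - intros y _. unfold f. auto_derive; [trivial|ring].
  - intros y _. apply (ex_derive_continuous (V := R_NormedModule)). auto_derive; trivial.
Qed.

(* The kernel [2 - r c e^-s - conj c e^s / r] equals [2 - 2 Re (c e^-iy)] at
   [s = ln r + i y], hence is nonnegative there; the mean over [y] of its
   product with [F (z + e^s)] does not depend on [Re s], and tends to
   [2 F z - r c F' z] as [Re s] tends to -oo. *)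
Lemma borel_caratheodory (F : C -> C) (z l c : C) (r : R) :
  0 < r -> Cmod c = 1 ->
  (forall w, Cmod (w - z)%C <= r -> exists l', has_cderive F w l') ->
  (forall w, Cmod (w - z)%C <= r -> 0 <= Re (F w)) ->
  has_cderive F z l ->
  r * Re (c * l)%C <= 2 * Re (F z).
Proof.
  intros Hr Hc HF Hpos Hl.
  pose (ker := fun s => (2 + ((- (r * c)) * Cexp (- s) + (- (/ r * Cconj c)) * Cexp s))%C).
  pose (H := fun s => (F (z + Cexp s) * ker s)%C).
  assert (Hpi := PI_RGT_0).
  assert (Hholo : forall a, holo_on_rect H a (ln r) 0 (2 * PI)).
  { intros a x y Hx Hy.
    destruct (HF (z + Cexp (x, y))%C) as [l' Hl'].
    { replace (z + Cexp (x, y) - z)%C with (Cexp (x, y)) by ring.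
      rewrite Cmod_Cexp. simpl. rewrite <- (exp_ln r) by exact Hr.
      destruct (Req_dec x (ln r)) as [->|]; [lra|]. left. apply exp_increasing. lra. }
    eexists. unfold H, ker. apply has_cderive_mult.
    - apply has_cderive_comp; [exact Hl'|].
      apply has_cderive_plus; [apply has_cderive_const|apply has_cderive_Cexp].
    - apply has_cderive_plus; [apply has_cderive_const|].
      apply has_cderive_plus; apply has_cderive_scal; [|apply has_cderive_Cexp].
      apply (has_cderive_comp Cexp Copp); [apply has_cderive_Cexp|].
      replace Copp with (fun w => (- (1)) * w)%C.
      2:{ apply functional_extensionality. intros w; ring. }
      apply has_cderive_scal, has_cderive_id. }
  assert (Hper : forall x, H (x, 2 * PI) = H (x, 0)).
  { intros x. unfold H, ker.
    replace (Cexp (x, 2 * PI)) with (Cexp (x, 0)).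
    2:{ unfold Cexp; simpl. rewrite sin_2PI, cos_2PI, sin_0, cos_0. reflexivity. }
    replace (Cexp (- (x, 2 * PI))) with (Cexp (- (x, 0))); [reflexivity|].
    unfold Cexp; simpl. rewrite !cos_neg, !sin_neg, sin_2PI, cos_2PI, sin_0, cos_0. reflexivity. }
  assert (Hend : forall y, 0 <= Re (H (ln r, y))).
  { intros y.
    assert (K : ker (ln r, y) = RtoC (2 - 2 * (Re c * cos y + Im c * sin y))).
    { unfold ker, Cexp. simpl. rewrite exp_Ropp, cos_neg, sin_neg, exp_ln by exact Hr.
      apply injective_projections; simpl; unfold Re, Im; field; lra. }
    unfold H. rewrite K, re_scal_r.
    apply Rmult_le_pos.
    - apply Hpos. replace (z + Cexp (ln r, y) - z)%C with (Cexp (ln r, y)) by ring.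
      rewrite Cmod_Cexp. simpl. rewrite exp_ln by exact Hr. lra.
    (* As [c] has modulus 1, the kernel here is |c - e^iy|^2. *)
    - assert (Hc2 : Re c ^ 2 + Im c ^ 2 = 1) by (rewrite <- Cmod2_alt, Hc; ring).
      assert (Hcs := sin2_cos2 y). unfold Rsqr in Hcs.
      assert (Q := pow2_ge_0 (Re c - cos y)). assert (Q' := pow2_ge_0 (Im c - sin y)). nra. }
  assert (Hmean : forall a, a <= ln r -> 0 <= RInt (fun y => Re (H (a, y))) 0 (2 * PI)).
  { intros a Ha. rewrite (periodic_mean_constant H a (ln r)); try assumption; [|lra|apply Hholo].
    apply RInt_ge_0; [lra| |intros; apply Hend].
    apply (ex_RInt_vertical H a (ln r)); [apply Hholo| |]; lra. }
  apply Rnot_lt_le. intros Hlt.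
  set (A := F z) in *.
  (* Half the supposed excess: the constant [2 * Re A - r * Re (c * l) + eta] in the bound below is
     then [- eta], so the mean becomes negative. *)
  set (eta := (r * Re (c * l)%C - 2 * Re A) / 2).
  assert (Heta : 0 < eta) by (unfold eta; lra).
  (* The kernel is at most 4 r / rho in modulus, so the remainder contributes at most eta / 2. *)
  destruct (Hl (eta / (8 * r))) as [d [Hd Hloc]].
  { apply Rdiv_lt_0_compat; lra. }
  assert (Hl0 := Cmod_ge_0 l). assert (HA0 := Cmod_ge_0 A).
  (* The explicit vanishing terms are at most 2 |l| rho + |A| rho / r + |l| rho^2 / r, hence at most
     [rho * m] when [rho <= r]. *)
  set (m := 3 * Cmod l + Cmod A / r).
  assert (Hm : 0 <= m).
  { assert (0 <= Cmod A / r) by (apply Rdiv_le_0_compat; lra). unfold m. lra. }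
  set (rho := Rmin (Rmin (d / 2) r) (eta / (4 * (m + 1)))).
  assert (Hrho : 0 < rho).
  { repeat apply Rmin_glb_lt; try lra. apply Rdiv_lt_0_compat; lra. }
  assert (rho < d /\ rho <= r /\ rho * (4 * (m + 1)) <= eta) as (Hrho1 & Hrho2 & Hrho3).
  { assert (E1 := Rmin_l (Rmin (d / 2) r) (eta / (4 * (m + 1)))).
    assert (E2 := Rmin_l (d / 2) r). assert (E3 := Rmin_r (d / 2) r).
    assert (E4 := Rmin_r (Rmin (d / 2) r) (eta / (4 * (m + 1)))).
    fold rho in E1, E4. repeat split; try lra.
    apply Rle_div_r; lra. }
  set (a := ln rho).
  assert (Ha : a <= ln r).
  { unfold a. destruct (Req_dec rho r) as [->|]; [lra|]. left. apply ln_increasing; lra. }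
  assert (Hbound : forall y, Re (H (a, y)) <=
    (2 * Re A - r * Re (c * l)%C + eta) + Re ((- (r * c * A)) * Cexp (- (a, y)))%C).
  { intros y. set (w := Cexp (a, y)). set (w' := Cexp (- (a, y))).
    assert (Hw : Cmod w = rho) by (unfold w; rewrite Cmod_Cexp; apply exp_ln, Hrho).
    assert (Hww : (w * w')%C = 1) by apply Cexp_opp.
    assert (Hw' : Cmod w' = / rho).
    { apply Rmult_eq_reg_l with rho; [|lra]. rewrite <- Hw at 1. rewrite <- Cmod_mult, Hww, Cmod_1. field; lra. }
    set (R := (F (z + w) - A - l * w)%C).
    assert (HR : Cmod R <= eta / (8 * r) * rho).
    { unfold R. specialize (Hloc (z + w)%C). replace (z + w - z)%C with w in Hloc by ring.
      rewrite Hw in Hloc. apply Hloc, Hrho1. }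
    set (k := (/ r * Cconj c)%C).
    assert (Hk : Cmod k = / r).
    { unfold k. rewrite Cmod_mult, Cmod_conj, Hc, Cmod_inv, Cmod_R, Rabs_pos_eq; [ring|lra|].
      intros E; apply RtoC_inj in E; lra. }
    (* [T] collects what is small with [rho]. The product of [l * w] with the pole of the kernel is
       not small: by [w * w' = 1] it gives the constant [- (r * (c * l))]. *)
    set (T := (2 * (l * w) + (- (k * A * w) + - (k * l * (w * w))) + R * (2 + (- (r * c * w') + - (k * w))))%C).
    assert (E : H (a, y) = (2 * A + - (r * (c * l)) + - (r * c * A) * w' + T)%C).
    { unfold H, ker. fold w w' k.
      replace (F (z + w)%C) with (A + l * w + R)%C by (unfold R; ring).
      unfold T.
      transitivity (2 * A + - (r * (c * l)) * (w * w') + - (r * c * A) * w' +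
        (2 * (l * w) + (- (k * A * w) + - (k * l * (w * w))) + R * (2 + (- (r * c * w') + - (k * w)))))%C; [ring|].
      rewrite Hww. ring. }
    rewrite E, !re_plus, re_opp, !re_scal_l.
    enough (HT : Re T <= eta) by lra.
    apply Rle_trans with (Cmod T); [eapply Rle_trans; [apply Rle_abs|apply re_le_Cmod]|].
    unfold T.
    eapply Rle_trans; [apply Cmod_triangle|].
    assert (H2 : Cmod 2 = 2) by (rewrite Cmod_R, Rabs_pos_eq; lra).
    assert (T1 : Cmod (2 * (l * w) + (- (k * A * w) + - (k * l * (w * w))))%C <= rho * m).
    { eapply Rle_trans; [apply Cmod_triangle|].
      eapply Rle_trans; [apply Rplus_le_compat_l, Cmod_triangle|].
      rewrite !Cmod_opp, !Cmod_mult, H2, Hk, Hw. unfold m, Rdiv.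
      assert (/ r * rho <= 1).
      { apply Rmult_le_reg_l with r; [lra|]. rewrite <- Rmult_assoc, Rinv_r by lra. lra. }
      assert (/ r * rho * (Cmod l * rho) <= 1 * (Cmod l * rho)).
      { apply Rmult_le_compat_r; [nra|assumption]. }
      nra. }
    assert (T2 : Cmod (2 + (- (r * c * w') + - (k * w)))%C <= 4 * r * / rho).
    { eapply Rle_trans; [apply Cmod_triangle|].
      eapply Rle_trans; [apply Rplus_le_compat_l, Cmod_triangle|].
      rewrite !Cmod_opp, !Cmod_mult, H2, Hk, Hw, Hw', Hc, Cmod_R, Rabs_pos_eq by lra.
      assert (/ r * rho <= 1).
      { apply Rmult_le_reg_l with r; [lra|]. rewrite <- Rmult_assoc, Rinv_r by lra. lra. }
      assert (1 <= r * / rho).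
      { apply Rmult_le_reg_r with rho; [lra|]. rewrite Rmult_assoc, Rinv_l by lra. lra. }
      lra. }
    rewrite (Cmod_mult R).
    assert (T3 : Cmod R * Cmod (2 + (- (r * c * w') + - (k * w)))%C <=
      eta / (8 * r) * rho * (4 * r * / rho)).
    { apply Rmult_le_compat; try apply Cmod_ge_0; assumption. }
    replace (eta / (8 * r) * rho * (4 * r * / rho)) with (eta / 2) in T3 by (field; lra).
    nra. }
  assert (I := is_RInt_plus (V := R_NormedModule) _ _ _ _ _ _
    (is_RInt_const (V := R_NormedModule) 0 (2 * PI) (2 * Re A - r * Re (c * l)%C + eta))
    (is_RInt_Re_Cexp_period (- (r * c * A))%C a)).
  assert (J : RInt (fun y => Re (H (a, y))) 0 (2 * PI) <=
    (2 * PI - 0) * (2 * Re A - r * Re (c * l)%C + eta) + 0).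
  { eapply Rle_trans; [|right; exact (is_RInt_unique _ _ _ _ I)]. apply RInt_le.
    - lra.
    - apply (ex_RInt_vertical H a (ln r)); [apply Hholo| |]; lra.
    - eexists; exact I.
    - intros y _. apply Hbound. }
  specialize (Hmean a Ha). unfold eta in *. nra.
Qed.

(** * Derivative bound and mean value inequality *)

Lemma unit_phase (a : C) : exists c, Cmod c = 1 /\ (c * a)%C = RtoC (Cmod a).
Proof.
  destruct (Req_dec (Cmod a) 0) as [E|E].
  - exists 1%C. split; [apply Cmod_1|]. rewrite E, (Cmod_eq_0 _ E). ring.
  - assert (E' : RtoC (Cmod a) <> 0) by (intros H; apply RtoC_inj in H; lra).
    exists (Cconj a / RtoC (Cmod a))%C. split.
    + rewrite Cmod_div, Cmod_conj, Cmod_R, Rabs_pos_eq by (exact E' || apply Cmod_ge_0).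
      field; exact E.
    + transitivity (a * Cconj a / RtoC (Cmod a))%C; [field; exact E'|].
      rewrite <- Cmod2_conj, RtoC_pow. field. exact E'.
Qed.

(** The function B - u (F - F z) has nonnegative real part on the disc and the value B at its
    centre; [c] rotates its derivative onto the positive axis. *)
Lemma cderive_bound (F : C -> C) (z l u : C) (r B : R) :
  0 < r -> Cmod u = 1 ->
  (forall w, Cmod (w - z)%C <= r -> exists l', has_cderive F w l') ->
  (forall w, Cmod (w - z)%C <= r -> Re (u * (F w - F z))%C <= B) ->
  has_cderive F z l ->
  Cmod l <= 2 * B / r.
Proof.
  intros Hr Hu HF HB Hl.
  destruct (unit_phase (- u * l)%C) as [c [Hc Hcl]].
  assert (D : forall w l', has_cderive F w l' ->
    has_cderive (fun w => B + u * F z + (- u) * F w)%C w (- u * l')).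
  { intros w l' H. replace (- u * l')%C with (0 + - u * l')%C by ring.
    apply has_cderive_plus; [apply has_cderive_const|]. apply has_cderive_scal, H. }
  assert (K := borel_caratheodory (fun w => B + u * F z + (- u) * F w)%C z (- u * l) c r Hr Hc).
  rewrite Hcl, re_RtoC, Cmod_mult, Cmod_opp, Hu, Rmult_1_l in K.
  apply Rle_div_r; [exact Hr|]. rewrite Rmult_comm.
  eapply Rle_trans; [apply K|].
  - intros w Hw. destruct (HF w Hw) as [l' Hl']. eexists; apply D, Hl'.
  - intros w Hw. specialize (HB w Hw).
    replace (B + u * F z + - u * F w)%C with (B + - (u * (F w - F z)))%C by ring.
    rewrite re_plus, re_opp, re_RtoC. lra.
  - apply D, Hl.
  - right. f_equal. replace (B + u * F z + - u * F z)%C with (RtoC B) by ring. apply re_RtoC.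
Qed.

Lemma is_derive_Re_cderive (F : C -> C) (t : R) (l : C) :
  has_cderive F t l -> is_derive (fun s => Re (F (RtoC s))) t (Re l).
Proof.
  intros HF. split; [apply (is_linear_scal_l (K := R_AbsRing) (V := R_NormedModule))|].
  intros x Hx eps.
  apply (is_filter_lim_locally_unique (K := R_AbsRing) (V := R_NormedModule)) in Hx. subst x.
  destruct (HF eps (cond_pos eps)) as [d [Hd H]].
  exists (mkposreal d Hd). intros s Hs. specialize (H (RtoC s)).
  rewrite <- RtoC_minus, Cmod_R in H. specialize (H Hs).
  change (Rabs (Re (F (RtoC s)) - Re (F (RtoC t)) - (s - t) * Re l) <= eps * Rabs (s - t)).
  eapply Rle_trans; [|exact H].
  eapply Rle_trans; [|apply re_le_Cmod]. right. f_equal.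
  unfold Cminus at 1 2. rewrite !re_plus, !re_opp, re_scal_r. ring.
Qed.

(** The mean value theorem is applied to a real function, Re (c F) along the segment, with [c]
    rotating the total increment onto the positive axis. *)
Lemma cderive_mean_value (F : C -> C) (z w : C) (M : R) :
  (forall t, 0 <= t <= 1 -> exists l, has_cderive F (z + t * (w - z)) l /\ Cmod l <= M) ->
  Cmod (F w - F z)%C <= M * Cmod (w - z)%C.
Proof.
  intros HF. destruct (unit_phase (F w - F z)%C) as [c [Hc Hcl]].
  pose (phi := fun s : R => Re (c * F (z + s * (w - z)))%C).
  assert (D : forall t, 0 <= t <= 1 -> exists m, is_derive phi t m /\ Rabs m <= M * Cmod (w - z)%C).
  { intros t Ht. destruct (HF t Ht) as [l [Hl HM]].
    exists (Re (c * ((0 + (1 * (w - z) + t * 0)) * l))%C). split.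
    - apply (is_derive_Re_cderive (fun s => c * F (z + s * (w - z)))%C).
      apply has_cderive_scal.
      apply (has_cderive_comp F (fun s => z + s * (w - z))%C); [exact Hl|].
      apply has_cderive_plus; [apply has_cderive_const|].
      apply (has_cderive_mult (fun s => s) (fun _ => w - z)%C); [apply has_cderive_id|apply has_cderive_const].
    - eapply Rle_trans; [apply re_le_Cmod|].
      replace (c * ((0 + (1 * (w - z) + t * 0)) * l))%C with (c * (l * (w - z)))%C by ring.
      rewrite !Cmod_mult, Hc, Rmult_1_l. apply Rmult_le_compat_r; [apply Cmod_ge_0|exact HM]. }
  destruct (MVT_gen phi 0 1 (Derive phi)) as [t [Ht E]].
  - rewrite Rmin_left, Rmax_right by lra. intros t Ht.
    destruct (D t) as [m [Hm _]]; [lra|]. apply Derive_correct. eexists; exact Hm.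
  - rewrite Rmin_left, Rmax_right by lra. intros t Ht.
    destruct (D t Ht) as [m [Hm _]]. apply continuity_pt_filterlim.
    apply (ex_derive_continuous (V := R_NormedModule)). eexists; exact Hm.
  - rewrite Rmin_left, Rmax_right in Ht by lra.
    destruct (D t Ht) as [m [Hm HM]]. rewrite (is_derive_unique _ _ _ Hm) in E.
    replace (Cmod (F w - F z)%C) with (phi 1 - phi 0).
    + rewrite E. rewrite Rminus_0_r, Rmult_1_r.
      eapply Rle_trans; [apply Rle_abs|exact HM].
    + unfold phi. replace (z + RtoC 1 * (w - z))%C with w by ring.
      replace (z + RtoC 0 * (w - z))%C with z by ring.
      rewrite <- (re_RtoC (Cmod _)), <- Hcl.
      replace (c * (F w - F z))%C with (c * F w + - (c * F z))%C by ring.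
      rewrite re_plus, re_opp. ring.
Qed.

(** * Distance to the boundary *)

(** The boundary point sits at the supremum of the parameters up to which the segment from [z] stays
    in [G]. *)
Lemma boundary_on_segment (G : C -> Prop) (z w : C) :
  G z -> ~ G w -> exists b, boundary G b /\ Cmod (z - b)%C <= Cmod (z - w)%C.
Proof.
  intros Hz Hw.
  pose (gam := fun t : R => (z + t * (w - z))%C).
  assert (G0 : gam 0 = z) by (unfold gam; ring).
  assert (G1 : gam 1 = w) by (unfold gam; ring).
  assert (Hgam : forall s t, Cmod (gam s - gam t)%C = Rabs (s - t) * Cmod (w - z)%C).
  { intros s t. rewrite <- Cmod_R, <- Cmod_mult. f_equal. unfold gam. rewrite RtoC_minus. ring. }
  pose (E := fun t => 0 <= t <= 1 /\ forall s, 0 <= s <= t -> G (gam s)).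
  destruct (completeness E) as [t [Hub Hlub]].
  - exists 1. intros s [Hs _]. lra.
  - exists 0. split; [lra|]. intros s Hs. replace s with 0 by lra. rewrite G0. exact Hz.
  - assert (Ht0 : 0 <= t).
    { apply Hub. split; [lra|]. intros s Hs. replace s with 0 by lra. rewrite G0. exact Hz. }
    assert (Ht1 : t <= 1) by (apply Hlub; intros s [Hs _]; lra).
    exists (gam t). split.
    + intros eps.
      assert (Hm := Cmod_ge_0 (w - z)%C).
      set (eta := eps / (Cmod (w - z)%C + 1)).
      assert (Heta : 0 < eta) by (apply Rdiv_lt_0_compat; [apply cond_pos|lra]).
      assert (Hclose : forall s, Rabs (s - t) <= eta -> Cmod (gam s - gam t)%C < eps).
      { intros s Hs. rewrite Hgam.
        apply Rle_lt_trans with (eta * Cmod (w - z)%C).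
        - apply Rmult_le_compat_r; assumption.
        - replace (pos eps) with (eta * (Cmod (w - z)%C + 1)) by (unfold eta; field; lra). nra. }
      split.
      * destruct (classic (exists s, E s /\ t - eta < s)) as [[s [Hs Hst]]|Hno].
        -- exists (gam s). split; [apply Hs; destruct Hs; lra|].
           apply Hclose. assert (s <= t) by (apply Hub, Hs). apply Rabs_le_between. lra.
        -- assert (t <= t - eta); [|lra].
           apply Hlub. intros s Hs. apply Rnot_lt_le. intros Hst. apply Hno. exists s. tauto.
      (* If the segment stayed in [G] near [gam t], then either [t] is 1 and [w] lies in [G], or [E]
         reaches beyond its supremum. *)
      * apply NNPP. intros Hno.
        assert (Hin : forall s, Rabs (s - t) <= eta -> G (gam s)).
        { intros s Hs. apply NNPP. intros Hs'. apply Hno. exists (gam s). split; [exact Hs'|apply Hclose, Hs]. }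
        destruct (Rle_lt_dec 1 t) as [Ht|Ht].
        -- apply Hw. rewrite <- G1. apply Hin. apply Rabs_le_between. lra.
        -- assert (E (Rmin 1 (t + eta))).
           { assert (A := Rmin_l 1 (t + eta)). assert (B := Rmin_r 1 (t + eta)).
             split; [split; [apply Rmin_glb; lra|exact A]|].
             intros s Hs.
             destruct (classic (exists s', E s' /\ s < s')) as [[s' [Hs' Hlt]]|Hno'].
             - apply Hs'. lra.
             - apply Hin. assert (t <= s).
               { apply Hlub. intros s' Hs'. apply Rnot_lt_le. intros Hlt. apply Hno'. exists s'. tauto. }
               apply Rabs_le_between. lra. }
           assert (Rmin 1 (t + eta) <= t) by (apply Hub; assumption).
           assert (t < Rmin 1 (t + eta)) by (apply Rmin_glb_lt; lra). lra.
    + replace (z - gam t)%C with (t * (z - w))%C by (unfold gam; ring).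
      rewrite Cmod_mult, Cmod_R, Rabs_pos_eq by exact Ht0.
      assert (Hm := Cmod_ge_0 (z - w)%C). nra.
Qed.

Lemma disc_dist_boundary (G : C -> Prop) (z w : C) :
  G z -> Cmod (z - w)%C < dist_boundary G z -> G w.
Proof.
  intros Hz Hlt. apply NNPP. intros Hw.
  destruct (boundary_on_segment G z w Hz Hw) as [b [Hb Hbw]].
  revert Hlt. apply Rle_not_lt. apply Rle_trans with (2 := Hbw).
  unfold dist_boundary.
  destruct (Glb_Rbar_correct (fun r => exists w, boundary G w /\ r = Cmod (z - w)%C)) as [Hlb _].
  specialize (Hlb (Cmod (z - b)%C) (ex_intro _ b (conj Hb eq_refl))).
  (* The boundary point found excludes [p_infty]; for [m_infty] the value of [real] is 0 and the
     bound is trivial. *)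
  destruct (Glb_Rbar _) as [r| |]; simpl in *; [exact Hlb|contradiction|apply Cmod_ge_0].
Qed.

(** * Lipschitz classes on an extension domain *)

(** The common core of the modulus and the real part cases. The phase [u] may change with the disc,
    because only the modulus of the derivative is carried on. *)
Lemma analytic_Lip_of_one_sided_bound (omega : R -> R) (G : C -> Prop) (p : C -> C) (K : R) :
  is_majorant omega -> extension_domain omega G -> analytic_in G p -> 0 < K ->
  (forall z r, 0 < r -> (forall w, Cmod (w - z)%C <= r -> G w) ->
    exists u, Cmod u = 1 /\
      forall w, Cmod (w - z)%C <= r -> Re (u * (p w - p z))%C <= K * omega r) ->
  Lip omega G p.
Proof.
  intros (Hpos & _ & Hmon & H0 & Hdec) [_ HG] Hp HK HB.
  apply HG. exists (2 * K). split; [lra|].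
  intros z w Hz Hw Hzw.
  set (d := / 2 * dist_boundary G z) in *.
  assert (Hcz := Cmod_ge_0 (z - w)%C).
  (* The comparison at the end divides by [Cmod (z - w)]. *)
  destruct (Req_dec (Cmod (z - w)%C) 0) as [E|E].
  { assert (Ezw : z = w) by (apply Ceq_minus, Cmod_eq_0, E).
    subst w. replace (p z - p z)%C with (RtoC 0) by ring.
    rewrite E, H0, Cmod_0. lra. }
  assert (Hd : 0 < d) by lra.
  assert (HM : Cmod (p z - p w)%C <= 2 * (K * omega d) / d * Cmod (z - w)%C).
  { apply cderive_mean_value. intros t Ht.
    set (s := (w + t * (z - w))%C).
    assert (Hs : Cmod (s - z)%C < d).
    { replace (s - z)%C with ((t - 1) * (z - w))%C by (unfold s; ring).
      rewrite Cmod_mult, <- RtoC_minus, Cmod_R.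
      assert (Rabs (t - 1) <= 1) by (apply Rabs_le_between; lra).
      nra. }
    (* As [s] is closer than [d] to [z], this disc lies within distance less than [2 * d] of [z],
       and [2 * d] is the distance to the boundary. *)
    assert (Hdisc : forall v, Cmod (v - s)%C <= d -> G v).
    { intros v Hv. apply (disc_dist_boundary G z v Hz).
      replace (z - v)%C with (- ((v - s) + (s - z)))%C by ring. rewrite Cmod_opp.
      eapply Rle_lt_trans; [apply Cmod_triangle|]. unfold d in *. lra. }
    destruct (analytic_has_cderive G p s Hp) as [l Hl].
    { apply Hdisc. replace (s - s)%C with (RtoC 0) by ring. rewrite Cmod_0. lra. }
    destruct (HB s d Hd Hdisc) as [u [Hu Hub]].
    exists l. split; [exact Hl|].
    apply (cderive_bound p s l u d); try assumption.
    intros v Hv. apply (analytic_has_cderive G); [exact Hp|apply Hdisc, Hv]. }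
  eapply Rle_trans; [exact HM|].
  (* Monotonicity of omega t / t replaces the scale [d] by the smaller [Cmod (z - w)]. *)
  assert (Hd' := Hdec (Cmod (z - w)%C) d ltac:(lra) ltac:(lra)).
  replace (2 * (K * omega d) / d * Cmod (z - w)%C) with (2 * K * (omega d / d * Cmod (z - w)%C)) by (field; lra).
  apply Rmult_le_compat_l; [lra|].
  apply Rle_trans with (omega (Cmod (z - w)%C) / Cmod (z - w)%C * Cmod (z - w)%C).
  - apply Rmult_le_compat_r; assumption.
  - right. field. exact E.
Qed.

Lemma Lip_plus (omega : R -> R) (G : C -> Prop) (F1 F2 : C -> C) :
  Lip omega G F1 -> Lip omega G F2 -> Lip omega G (fun z => F1 z + F2 z)%C.
Proof.
  intros [M1 [HM1 H1]] [M2 [HM2 H2]]. exists (M1 + M2). split; [lra|].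
  intros z w Hz Hw. specialize (H1 z w Hz Hw). specialize (H2 z w Hz Hw).
  replace (F1 z + F2 z - (F1 w + F2 w))%C with ((F1 z - F1 w) + (F2 z - F2 w))%C by ring.
  eapply Rle_trans; [apply Cmod_triangle|]. lra.
Qed.

Lemma Lip_scal (omega : R -> R) (G : C -> Prop) (F : C -> C) (c : C) :
  Cmod c <= 1 -> Lip omega G F -> Lip omega G (fun z => c * F z)%C.
Proof.
  intros Hc [M [HM H]]. exists M. split; [exact HM|].
  intros z w Hz Hw. specialize (H z w Hz Hw).
  replace (c * F z - c * F w)%C with (c * (F z - F w))%C by ring.
  rewrite Cmod_mult. assert (A := Cmod_ge_0 (F z - F w)%C). nra.
Qed.

Lemma Lip_conj (omega : R -> R) (G : C -> Prop) (F : C -> C) :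
  Lip omega G F -> Lip omega G (fun z => Cconj (F z)).
Proof.
  intros [M [HM H]]. exists M. split; [exact HM|].
  intros z w Hz Hw. rewrite <- Cminus_conj, Cmod_conj. apply H; assumption.
Qed.

Lemma Lip_ext (omega : R -> R) (G : C -> Prop) (F1 F2 : C -> C) :
  (forall z, G z -> F1 z = F2 z) -> Lip omega G F1 -> Lip omega G F2.
Proof.
  intros E [M [HM H]]. exists M. split; [exact HM|].
  intros z w Hz Hw. rewrite <- !E by assumption. apply H; assumption.
Qed.

Lemma Lip_modulus (omega : R -> R) (G : C -> Prop) (F : C -> C) :
  Lip omega G F -> Lip omega G (modulus F).
Proof.
  intros [M [HM H]]. exists M. split; [exact HM|].
  intros z w Hz Hw. eapply Rle_trans; [|apply H; assumption].
  unfold modulus. rewrite <- RtoC_minus, Cmod_R.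
  assert (A := Cmod_triangle (F z - F w)%C (F w)). assert (B := Cmod_triangle (F w - F z)%C (F z)).
  replace (F z - F w + F w)%C with (F z) in A by ring.
  replace (F w - F z + F z)%C with (F w) in B by ring.
  replace (F w - F z)%C with (- (F z - F w))%C in B by ring. rewrite Cmod_opp in B.
  apply Rabs_le_between. lra.
Qed.

Lemma Lip_le_radius (omega : R -> R) (G : C -> Prop) (F : C -> C) :
  is_majorant omega -> Lip omega G F -> exists K, 0 < K /\
    forall z w r, G z -> G w -> Cmod (w - z)%C <= r -> Cmod (F w - F z)%C <= K * omega r.
Proof.
  intros (_ & _ & Hmon & _) [K [HK H]]. exists K. split; [exact HK|].
  intros z w r Hz Hw Hr. eapply Rle_trans; [apply H; assumption|].
  apply Rmult_le_compat_l; [lra|]. apply Hmon; [apply Cmod_ge_0|exact Hr].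
Qed.

(** With [u * p z = |p z|], the real part of [u * (p w - p z)] is at most |p w| - |p z|. No lower
    bound comes with it, since Re (u p w) may be far below |p w|. *)
Lemma analytic_Lip_of_modulus (omega : R -> R) (G : C -> Prop) (p : C -> C) :
  is_majorant omega -> extension_domain omega G -> analytic_in G p ->
  Lip omega G (modulus p) -> Lip omega G p.
Proof.
  intros Hom HG Hp HL.
  destruct (Lip_le_radius omega G _ Hom HL) as [K [HK H]].
  apply (analytic_Lip_of_one_sided_bound omega G p K); try assumption.
  intros z r Hr Hdisc. destruct (unit_phase (p z)) as [u [Hu Hup]].
  exists u. split; [exact Hu|]. intros w Hw.
  assert (Hz : G z).
  { apply Hdisc. replace (z - z)%C with (RtoC 0) by ring. rewrite Cmod_0. lra. }
  specialize (H z w r Hz (Hdisc w Hw) Hw).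
  unfold modulus in H. rewrite <- RtoC_minus, Cmod_R in H. apply Rabs_le_between in H.
  replace (u * (p w - p z))%C with (u * p w + - (u * p z))%C by ring.
  rewrite Hup, re_plus, re_opp, re_RtoC.
  assert (A := Rle_trans _ _ _ (Rle_abs _) (re_le_Cmod (u * p w)%C)).
  rewrite Cmod_mult, Hu in A. lra.
Qed.

(** Phases 1 compare real parts, phases [- Ci] imaginary parts. *)
Lemma analytic_Lip_of_Re (omega : R -> R) (G : C -> Prop) (p F : C -> C) (u v : C) :
  is_majorant omega -> extension_domain omega G -> analytic_in G p -> Lip omega G F ->
  Cmod u = 1 -> Cmod v = 1 ->
  (forall z, G z -> Re (u * p z)%C = Re (v * F z)%C) ->
  Lip omega G p.
Proof.
  intros Hom HG Hp HL Hu Hv HRe.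
  destruct (Lip_le_radius omega G _ Hom HL) as [K [HK H]].
  apply (analytic_Lip_of_one_sided_bound omega G p K); try assumption.
  intros z r Hr Hdisc. exists u. split; [exact Hu|]. intros w Hw.
  assert (Hz : G z).
  { apply Hdisc. replace (z - z)%C with (RtoC 0) by ring. rewrite Cmod_0. lra. }
  specialize (H z w r Hz (Hdisc w Hw) Hw).
  replace (u * (p w - p z))%C with (u * p w + - (u * p z))%C by ring.
  rewrite re_plus, re_opp, (HRe z Hz), (HRe w (Hdisc w Hw)), <- re_opp, <- re_plus.
  replace (v * F w + - (v * F z))%C with (v * (F w - F z))%C by ring.
  eapply Rle_trans; [apply Rle_abs|]. eapply Rle_trans; [apply re_le_Cmod|].
  rewrite Cmod_mult, Hv. lra.
Qed.

Theorem theorem3 (omega : R -> R) (G : C -> Prop) (f g h : C -> C)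
  (Homega : is_majorant omega)
  (Hdini : dini_regular omega)
  (HG : extension_domain omega G)
  (Hg : analytic_in G g)
  (Hh : analytic_in G h)
  (Hf : forall z, G z -> f z = (h z + Cconj (g z))%C) :
  (Lip omega G f <-> Lip omega G g /\ Lip omega G h) /\
  (Lip omega G g /\ Lip omega G h <->
   Lip omega G (modulus g) /\ Lip omega G (modulus h)).
Proof.
  split; split.
  - intros HL.
    assert (Hi : Cmod (- Ci) = 1) by (rewrite Cmod_opp; apply Cmod_Ci).
    assert (Hsum : Lip omega G (fun z => h z + g z)%C).
    { apply (analytic_Lip_of_Re omega G _ f 1 1); try assumption; try apply Cmod_1.
      - intros z Hz. exact (ex_derive_plus (K := C_AbsRing) (V := C_NormedModule) h g z (Hh z Hz) (Hg z Hz)).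
      - intros z Hz. rewrite Hf by exact Hz. rewrite !Cmult_1_l, !re_plus, re_conj. reflexivity. }
    assert (Hdiff : Lip omega G (fun z => h z - g z)%C).
    { apply (analytic_Lip_of_Re omega G _ f (- Ci) (- Ci)); try assumption.
      - intros z Hz. exact (ex_derive_minus (K := C_AbsRing) (V := C_NormedModule) h g z (Hh z Hz) (Hg z Hz)).
      - intros z Hz. rewrite Hf by exact Hz. simpl. unfold Re, Im. ring. }
    assert (Hhalf : Cmod (/ 2) <= 1).
    { rewrite Cmod_inv, Cmod_R, Rabs_pos_eq; try lra. intros E; apply RtoC_inj in E; lra. }
    split.
    (* g is half of (h + g) - (h - g). *)
    + eapply Lip_ext; [|exact (Lip_scal _ _ _ (/ 2) Hhalf (Lip_plus _ _ _ _ Hsum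
        (Lip_scal _ _ _ (- (1)) ltac:(rewrite Cmod_opp, Cmod_1; lra) Hdiff)))].
      intros z _. cbv beta. field.
    + eapply Lip_ext; [|exact (Lip_scal _ _ _ (/ 2) Hhalf (Lip_plus _ _ _ _ Hsum Hdiff))].
      intros z _. cbv beta. field.
  - intros [H1 H2]. eapply Lip_ext; [|exact (Lip_plus _ _ _ _ H2 (Lip_conj _ _ _ H1))].
    intros z Hz. symmetry. apply Hf, Hz.
  - intros [H1 H2]. split; apply Lip_modulus; assumption.
  - intros [H1 H2]. split; apply (analytic_Lip_of_modulus omega G); assumption.
Qed.
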